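(* Let $G=\mathrm{Circ}(a_0,\ldots,a_{n-1})$ be a Hermitian circulant with universal perfect state transfer. If $n$ is a prime, the square of a prime, or a power of two, then $a_j\neq 0$ for all $j=1,\ldots,n-1$ (i.e. $G$ is dense).
   Context: $\mathrm{Circ}(a_0,\ldots,a_{n-1})$ denotes the $n\times n$ matrix $C$ with $C_{j,k}=a_{k-j}$ (indices in $\mathbb{Z}/n\mathbb{Z}$), the adjacency matrix of a weighted graph. A graph with Hermitian adjacency matrix $A$ has universal perfect state transfer if for every pair of vertices $v,w$ there is $t>0$ with $|\langle w|e^{-\mathtt{i} At}|v\rangle|=1$. A circulant is dense if $a_j\ne 0$ for $j=1,\ldots,n-1$. *)

(* Defs.v *)
From HB Require Import structures.
From mathcomp Require Import all_boot all_order all_algebra.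
From mathcomp Require Import all_classical all_reals.
From mathcomp Require Import topology normedtype.
From mathcomp.real_closed Require Import complex.
Set Implicit Arguments. Unset Strict Implicit. Unset Printing Implicit Defensive.
Import Order.TTheory GRing.Theory Num.Theory.
Import numFieldTopology.Exports numFieldNormedType.Exports.
Local Open Scope ring_scope.
Local Open Scope complex_scope.
Local Open Scope classical_set_scope.

(* the library's standard (norm-induced) topology on the numFieldType R[i] *)
#[non_forgetful_inheritance]
HB.instance Definition _ (R : rcfType) :=
  PseudoPointedMetric.copy (R[i]) (R[i])^o.

Definition circ (C : pzRingType) (n : nat) (a : nat -> C) : 'M[C]_n :=
  \matrix_(j < n, k < n) a ((k + n - j) %% n)%N.

Definition hermitian_mx (R : realType) (n : nat) (A : 'M[R[i]]_n) : Prop :=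
  forall j k : 'I_n, A k j = (A j k)^*.

Definition expmx_partial (R : realType) (n : nat) (A : 'M[R[i]]_n) (t : R)
  (N : nat) : 'M[R[i]]_n :=
  \sum_(m < N) (((- 'i * t%:C) ^+ m) / (m`!)%:R) *: A ^+ m.

Definition expmx_entry_is (R : realType) (n : nat) (A : 'M[R[i]]_n) (t : R)
  (w v : 'I_n) (c : R[i]) : Prop :=
  (fun N => expmx_partial A t N w v) @ \oo --> c.

Definition universal_pst (R : realType) (n : nat) (A : 'M[R[i]]_n) : Prop :=
  forall v w : 'I_n, exists t : R, 0 < t /\
    exists c : R[i], expmx_entry_is A t w v c /\ `|c| = 1.

Definition dense_circ (R : realType) (n : nat) (a : nat -> R[i]) : Prop :=
  forall j : nat, (0 < j < n)%N -> a j != 0.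

(* Main.v *)
(* A Hermitian circulant has real eigenvalues l_k on the Fourier basis, and transfer
   from vertex 0 to vertex 1 at time t forces exp(i (l_k - l_0) t) = exp(2 pi i k / n),
   i.e. after rescaling l_k - l_0 = k + n m_k with m_k integers.  Inverting the Fourier
   transform, a_j = 0 gives sum_k (k + n m_k) z^k = 0 for an n-th root of unity z != 1.
   Since (z - 1) sum_k k z^k = n, this reads (1 - z) sum_k m_k z^k = 1, so 1 - z is a
   unit among the algebraic integers; this is impossible when n is a power of a prime. *)
Require Import Defs.
From HB Require Import structures.
From mathcomp Require Import all_boot all_order all_algebra.
From mathcomp Require Import all_classical all_reals.
From mathcomp Require Import topology normedtype sequences trigo ring.
From mathcomp.real_closed Require Import complex.
Import Order.TTheory GRing.Theory Num.Theory.
Import numFieldTopology.Exports numFieldNormedType.Exports.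
Set Implicit Arguments. Unset Strict Implicit. Unset Printing Implicit Defensive.
Local Open Scope ring_scope.
Local Open Scope complex_scope.
Local Open Scope classical_set_scope.

(** * Complex limits and the power series of exp(-ix) *)

(** Both parts are bounded by the modulus. This reduces the complex limit in [expmx_entry_is] to the
    real cosine and sine series. *)
Lemma cvg_complex_Re_Im (R : realType) (f : nat -> R[i]) (c : R[i]) :
  f @ \oo --> c ->
  (fun N => complex.Re (f N)) @ \oo --> complex.Re c /\
  (fun N => complex.Im (f N)) @ \oo --> complex.Im c.
Proof.
move=> fc.
have {}fc (e : R) : 0 < e -> \forall N \near \oo, `|c - f N| < e%:C.
  move=> e0; have e0C : 0 < e%:C by rewrite ltcR.
  have := fc _ (nbhsx_ballx c (e%:C) e0C).
  by rewrite /= /ball /=; apply.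
split; apply/cvgrPdist_lt => e e0; near=> N.
- rewrite -raddfB -ltcR; apply: le_lt_trans (normc_ge_Re _) _.
  by near: N; exact: fc.
- have imle (z : R[i]) : `|complex.Im z|%:C <= `|z|.
    by have := normc_ge_Re (z * 'i%C); rewrite ReiNIm normrN normrM complexiE normCi mulr1.
  rewrite -raddfB -ltcR; apply: le_lt_trans (imle _) _.
  by near: N; exact: fc.
Unshelve. all: by end_near. Qed.

Lemma expNi_coeff (R : realType) (x : R) (m : nat) :
  (- 'i * x%:C) ^+ m / (m`!)%:R =
  cos_coeff x m +i* (- sin_coeff x m) :> R[i].
Proof.
(* Powers of -i sorted by parity, with the half exponents in the form used by [cos_coeffE] and
   [sin_coeffE]. *)
have NiE : (- 'i)%R ^+ m = ((~~ odd m)%:R * (-1) ^+ m./2) +i*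
    (- ((odd m)%:R * (-1) ^+ m.-1./2)) :> R[i].
  have Ni2 h : (- 'i)%R ^+ h.*2 = ((-1) ^+ h)%:C :> R[i].
    by rewrite -mul2n exprM sqrrN sqrCi rmorphXn rmorphN rmorph1.
  rewrite -{1}(odd_double_half m) exprD Ni2.
  case: (boolP (odd m)) => om /=; last by simpc.
  rewrite expr1 -complexiE; simpc.
  by congr (_ +i* - (_ ^+ _)); case: m om => //= m; rewrite uphalf_half => /negPf ->.
rewrite exprMn NiE -rmorphXn.
have -> : ((m`!)%:R : R[i])^-1 = ((m`!)%:R^-1 : R)%:C by rewrite fmorphV rmorph_nat.
rewrite cos_coeffE sin_coeffE /=; simpc.
by congr (_ +i* _); rewrite ?mulNr mulrAC.
Qed.

(** * Algebraic integers and roots of unity of prime-power order *)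

(** Multiplying a monic integer equation for 1/p by p^deg leaves 1 plus a multiple of p equal to
    0. *)
Lemma inv_prime_not_integral (F : numFieldType) (p : nat) :
  prime p -> ~ integralOver (intr : int -> F) (p%:R^-1).
Proof.
move=> p_pr [q /monicP q1 /rootP].
have pF0 : p%:R != 0 :> F by rewrite pnatr_eq0 -lt0n prime_gt0.
have q_gt0 : (0 < size q)%N by rewrite lt0n size_poly_eq0 -lead_coef_eq0 q1.
rewrite horner_coef size_map_inj_poly ?rmorph0 //; last exact: intr_inj.
move=> /(congr1 ( *%R (p%:R ^+ (size q).-1))); rewrite mulr0 big_distrr /=.
have -> : \sum_(i < size q) p%:R ^+ (size q).-1 * ((map_poly intr q)`_i * p%:R^-1 ^+ i) =
    (\sum_(i < size q) q`_i * p%:R ^+ ((size q).-1 - i))%:~R :> F.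
  rewrite rmorph_sum; apply: eq_bigr => i _ /=.
  rewrite coef_map /= intrM rmorphXn /= exprVn mulrCA; congr (_ * _).
  have ile : (i <= (size q).-1)%N by rewrite -ltnS prednK.
  by rewrite -{1}(subnK ile) exprD mulfK ?expf_neq0 // rmorph_nat.
move=> /eqP; rewrite intr_eq0 -(prednK q_gt0) big_ord_recr /= subnn expr0 mulr1.
rewrite -lead_coefE q1 addr_eq0 => /eqP sumE.
(* Below the leading term the exponent of p is positive. *)
have : (p %| (\sum_(i < (size q).-1) q`_i * p%:R ^+ ((size q).-1 - i)))%Z.
  apply: rpred_sum => i _.
  rewrite -(prednK (_ : 0 < (size q).-1 - i)%N) ?subn_gt0 // exprS mulrCA.
  by apply: dvdz_mulr; rewrite natz.
by rewrite sumE dvdzE abszN /= dvdn1 => /eqP p1; rewrite p1 in p_pr.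
Qed.

(** The absorption identity makes p^s divide k * C(p^s, k). If p did not divide the binomial, p^s
    would divide k, which is too small. *)
Lemma prime_dvd_bin_exp (p s k : nat) :
  prime p -> (0 < k < p ^ s)%N -> (p %| 'C(p ^ s, k))%N.
Proof.
move=> p_pr /andP[k0 ks].
have [//|pC] := boolP (p %| 'C(p ^ s, k))%N.
have cop : coprime (p ^ s) 'C(p ^ s, k) by rewrite coprimeXl // prime_coprime.
have : (p ^ s %| k * 'C(p ^ s, k))%N.
  by case: k k0 {ks pC cop} => // k _; rewrite mul_bin_left; case: (p ^ s)%N => [|m];
    rewrite ?mul0n // -mul_bin_left -mul_bin_diag dvdn_mulr.
by rewrite Gauss_dvdl // => /dvdn_leq -/(_ k0); rewrite leqNgt ks.
Qed.

Lemma integral_expr (A K : comNzRingType) (f : {rmorphism A -> K}) (x : K) (m : nat) :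
  integralOver f x -> integralOver f (x ^+ m).
Proof.
by move=> fx; elim: m => [|m IH]; rewrite ?expr0 ?exprS; [exact: integral1|exact: integral_mul].
Qed.

Lemma integral_sum (A K : comNzRingType) (f : {rmorphism A -> K}) (m : nat)
  (F : 'I_m -> K) :
  (forall i, integralOver f (F i)) -> integralOver f (\sum_(i < m) F i).
Proof.
by move=> fF; apply: big_ind => //; [exact: integral0|move=> x y; exact: integral_add].
Qed.

Lemma integral_root_of_unity (F : numFieldType) (n : nat) (z : F) :
  (0 < n)%N -> z ^+ n = 1 -> integralOver (intr : int -> F) z.
Proof.
move=> n_gt0 zn; exists ('X^n - 1); first exact: monicXnsubC.
by rewrite rmorphB /= map_polyXn rmorph1 rootE !hornerE zn subrr.
Qed.

(* Modulo [p], [1 = ((1 - z) + z) ^ (p ^ s)] is [(1 - z) ^ (p ^ s) + 1], so a unit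
   [1 - z] would make [p] invertible among the algebraic integers. *)
Lemma one_sub_root_not_unit (F : numFieldType) (p s : nat) (z y : F) :
  prime p -> z ^+ (p ^ s) = 1 -> integralOver (intr : int -> F) y ->
  (1 - z) * y <> 1.
Proof.
move=> p_pr zq iy zy1; set q := (p ^ s)%N in zq *.
have q_gt0 : (0 < q)%N by rewrite expn_gt0 prime_gt0.
have pF0 : p%:R != 0 :> F by rewrite pnatr_eq0 -lt0n prime_gt0.
have iz := integral_root_of_unity q_gt0 zq.
have := exprDn (1 - z) z q; rewrite subrK expr1n.
rewrite big_ord_recr /= subnn expr0 mul1r binn zq mulr1n.
(* Both end terms of the binomial expansion are now split off: [1] and [(1 - z) ^+ q]. The middle
   terms form [S], a multiple of p. *)
rewrite -(prednK q_gt0) big_ord_recl /= prednK // subn0 expr0 mulr1 bin0 mulr1n.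
set S := \sum_(i < _) _ => eq1.
pose u := \sum_(i < q.-1) (1 - z) ^+ (q - bump 0 i) * z ^+ bump 0 i *+
   ('C(q, bump 0 i) %/ p).
have Su : S = p%:R * u.
  rewrite /S big_distrr; apply: eq_bigr => i _ /=.
  rewrite mulr_natl -mulrnA divnK // prime_dvd_bin_exp //= /bump /= add1n.
  by rewrite -/q -[X in (_ < X)%N](prednK q_gt0) ltnS.
have iu : integralOver (intr : int -> F) u.
  apply: integral_sum => i; rewrite -mulr_natr.
  apply: integral_mul; last exact: integral_nat.
  apply: integral_mul; apply: integral_expr => //.
  by apply: integral_sub => //; exact: integral1.
apply: (@inv_prime_not_integral F p p_pr).
(* From (1 - z)^q = -S = -p u and ((1 - z) y)^q = 1. *)
suff -> : p%:R^-1 = - (u * y ^+ q).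
  by apply: integral_opp; apply: integral_mul => //; apply: integral_expr.
apply: (mulfI pF0); rewrite divff // mulrN mulrA -Su -mulNr.
have -> : - S = (1 - z) ^+ q.
  move/(congr1 (+%R^~ (- 1 - S))): eq1; rewrite addrA subrr sub0r => ->.
  by rewrite addrA addrK addrK.
by rewrite -exprMn zy1 expr1n.
Qed.

(** * Geometric sums at a root of unity *)

Lemma sum_expr_root (F : fieldType) (n : nat) (z : F) :
  z ^+ n = 1 -> z != 1 -> \sum_(k < n) z ^+ k = 0.
Proof.
move=> zn z1; apply: (mulfI (_ : z - 1 != 0)); first by rewrite subr_eq0.
by rewrite -subrX1 zn subrr mulr0.
Qed.

Lemma sum_natmul_expr (F : fieldType) (n : nat) (z : F) :
  z ^+ n = 1 -> z != 1 -> (z - 1) * (\sum_(k < n) k%:R * z ^+ k) = n%:R.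
Proof.
move=> zn z1.
(* Summation by parts, with a free upper bound so that induction applies. *)
suff gen N : (z - 1) * (\sum_(k < N) k%:R * z ^+ k) =
    N%:R * z ^+ N - z * \sum_(k < N) z ^+ k.
  by rewrite gen zn mulr1 sum_expr_root // mulr0 subr0.
elim: N => [|N IH]; first by rewrite !big_ord0 !mulr0 mul0r subrr.
rewrite !big_ord_recr /= mulrDr IH exprS -natr1.
set S := \sum_(k < N) _; set x := z ^+ N.
by ring.
Qed.

(** * The unit circle *)

(** This is e^(ix), built from the real cosine and sine so that real trigonometry applies
    directly. *)
Definition cis (R : realType) (x : R) : R[i] := cos x +i* sin x.

Lemma cisD (R : realType) (x y : R) : cis (x + y) = cis x * cis y.
Proof. by rewrite /cis cosD sinD; simpc; rewrite [cos x * sin y + _]addrC. Qed.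

Lemma cis0 (R : realType) : cis (0 : R) = 1.
Proof. by rewrite /cis cos0 sin0. Qed.

Lemma cisMn (R : realType) (x : R) (m : nat) : cis (x *+ m) = cis x ^+ m.
Proof.
by elim: m => [|m IH]; rewrite ?mulr0n ?expr0 ?cis0 // mulrS cisD IH exprS.
Qed.

Lemma conj_cis (R : realType) (x : R) : (cis x)^* = cis (- x).
Proof. by rewrite /cis cosN sinN. Qed.

Lemma norm_cis (R : realType) (x : R) : `|cis x| = 1.
Proof. by rewrite normc_def /= cos2Dsin2 sqrtr1. Qed.

Lemma cis_neq0 (R : realType) (x : R) : cis x != 0.
Proof. by rewrite -normr_eq0 norm_cis oner_eq0. Qed.

Lemma cis2pi (R : realType) : cis (pi *+ 2 : R) = 1.
Proof. by rewrite /cis cos2pi sin2pi. Qed.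

Lemma cis_eq1 (R : realType) (x : R) :
  cis x = 1 -> exists m : int, x = m%:~R * (pi *+ 2).
Proof.
move=> x1; pose T : R := pi *+ 2; pose m := Num.floor (x / T).
have T0 : 0 < T by rewrite /T pmulrn_lgt0 // pi_gt0.
have cisT (k : int) : cis (k%:~R * T) = 1.
  case: k => k; rewrite ?NegzE ?mulrNz ?mulNr -?conj_cis mulr_natl cisMn cis2pi expr1n //.
  by rewrite conjc1.
exists m; apply/eqP; rewrite -subr_eq0.
(* [r] is [x] reduced to [0, 2 pi). If it were positive, cos r = 1 would force sin(r/2) = 0 with r/2
   strictly between 0 and pi. *)
set r := x - _; have r1 : cis r = 1.
  by apply: (mulIf (cis_neq0 (m%:~R * T))); rewrite -cisD subrK x1 cisT mulr1.
have /andP[m1 m2] : m%:~R <= x / T < (m + 1)%:~R by exact: floor_itv.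
have r_ge0 : 0 <= r by rewrite subr_ge0 -ler_pdivlMr.
have r_lt : r < T.
  by rewrite ltrBlDl -/T -[X in _ + X]mul1r -mulrDl -ltr_pdivrMr // -intrD1.
rewrite eq_le r_ge0 andbT leNgt; apply/negP => r_gt0.
have h0 : 0 < sin (r / 2).
  by apply: sin_gt0_pi; rewrite divr_gt0 ?ltr0n //= ltr_pdivrMr ?ltr0n // mulr_natr.
move: r1 => [+ _]; rewrite (_ : r = r / 2 *+ 2); last by rewrite -mulr_natr divfK ?pnatr_eq0.
rewrite cos_mulr2n cos2sin2 mulrnBl -addrA => /eqP.
rewrite -subr_eq0 => /eqP eq0.
have : sin (r / 2) ^+ 2 *+ 2 = 0 by rewrite -[LHS]opprK -[RHS]oppr0 -eq0; ring.
by move/eqP; rewrite mulrn_eq0 /= sqrf_eq0 gt_eqF.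
Qed.

(** * Fourier analysis of circulants *)

(** The discrete Fourier transform of the first row, for [w] an n-th root of unity. *)
Definition circ_eigenvalue (C : pzRingType) (n : nat) (w : C) (a : nat -> C)
  (k : nat) : C := \sum_(m < n) a m * w ^+ (m * k).

Section CircSpectrum.
Variables (F : fieldType) (n' : nat) (w : F) (a : nat -> F).
Let n := n'.+1.
Hypothesis w_prim : n.-primitive_root w.

Lemma sum_prim_root_exp (d : nat) :
  \sum_(k < n) w ^+ (k * d) = if (n %| d)%N then n%:R else 0.
Proof.
case: ifPn => nd.
  under eq_bigr => k _.
    rewrite (eqP (_ : w ^+ (k * d) == 1)) -?(prim_order_dvd w_prim) ?dvdn_mull //. over.
  by rewrite sumr_const card_ord.
under eq_bigr do rewrite mulnC exprM.
apply: sum_expr_root; last by rewrite -(prim_order_dvd w_prim).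
by rewrite exprAC (prim_expr_order w_prim) expr1n.
Qed.

Lemma circ_eigenvector (j : 'I_n) (k : nat) :
  \sum_(l < n) circ n a j l * w ^+ (l * k) = circ_eigenvalue n w a k * w ^+ (j * k).
Proof.
rewrite /circ_eigenvalue big_distrl (reindex_inj (addIr j)) /=.
apply: eq_bigr => m _; rewrite mxE /=.
rewrite -addnBA ?(ltnW (ltn_ord j)) // modnDml -addnA.
rewrite subnKC ?(ltnW (ltn_ord j)) // modnDr modn_small ?ltn_ord //.
by rewrite exprM (prim_expr_mod w_prim) -exprM mulnDl exprD mulrA.
Qed.

(** The spectral decomposition of the powers, with the factor 1/n cleared. Writing [u + n - v] for u
    - v avoids truncated subtraction. *)
Lemma circ_pow_entry (m : nat) (u v : 'I_n) :
  n%:R * (circ n a ^+ m) u v =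
  \sum_(k < n) circ_eigenvalue n w a k ^+ m * w ^+ (k * (u + n - v)).
Proof.
elim: m u => [|m IH] u.
  under eq_bigr do rewrite expr0 mul1r.
  rewrite sum_prim_root_exp expr0 mxE.
  (* In the base case, orthogonality of characters must reproduce the identity matrix. *)
  have -> : (n %| u + n - v)%N = (u == v).
    apply/idP/eqP => [|->]; last by rewrite addKn.
    rewrite /dvdn -addnBA ?(ltnW (ltn_ord v)) // => uv; apply/val_inj => /=.
    rewrite -[LHS](modn_small (ltn_ord u)) -[RHS](modn_small (ltn_ord v)).
    apply/eqP; rewrite -(eqn_modDr (n - v)) (eqP uv).
    by rewrite subnKC ?modnn ?(ltnW (ltn_ord v)).
  by case: eqP; rewrite ?mulr1 ?mulr0.
rewrite exprS mxE big_distrr /=.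
under eq_bigr do rewrite mulrCA IH big_distrr /=.
rewrite exchange_big; apply: eq_bigr => k _ /=.
transitivity (\sum_(l < n) circ n a u l * w ^+ (l * k) *
    (circ_eigenvalue n w a k ^+ m * w ^+ (k * (n - v)))).
  apply: eq_bigr => l _; rewrite -[RHS]mulrA; congr (_ * _).
  rewrite [RHS]mulrCA; congr (_ * _).
  by rewrite -exprD -addnBA ?(ltnW (ltn_ord v)) // mulnDr [(l * k)%N]mulnC.
rewrite -big_distrl circ_eigenvector /= exprS -!mulrA; congr (_ * _).
rewrite mulrCA; congr (_ * _).
by rewrite -exprD -addnBA ?(ltnW (ltn_ord v)) // mulnDr [(u * k)%N]mulnC.
Qed.

(** Row 0 of the spectral decomposition for the first power. *)
Lemma circ_eigenvalue_inversion (j : nat) : (j < n)%N ->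
  \sum_(k < n) circ_eigenvalue n w a k * w ^+ (k * (n - j)) = n%:R * a j.
Proof.
move=> jn; have := circ_pow_entry 1 ord0 (Ordinal jn).
rewrite expr1 mxE /= add0n subn0 modnDr modn_small // => ->.
Qed.

End CircSpectrum.

(** Conjugation sends a_m to a_(-m) and w to its inverse, so it only reindexes the sum by m -> -m.
    Hence the eigenvalues are real. *)
Lemma hermitian_circ_eigenvalue_conj (R : realType) (n' : nat) (w : R[i])
  (a : nat -> R[i]) (k : nat) : w ^+ n'.+1 = 1 -> w^* = w^-1 ->
  hermitian_mx (circ n'.+1 a) ->
  (circ_eigenvalue n'.+1 w a k)^* = circ_eigenvalue n'.+1 w a k.
Proof.
move=> wn wJ hA; rewrite /circ_eigenvalue raddf_sum [RHS](reindex_inj oppr_inj) /=.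
apply: eq_bigr => m _; rewrite rmorphM rmorphXn /= wJ.
have w0 : w != 0 by apply/eqP => w0; move: wn; rewrite w0 exprS mul0r => /esym/eqP; rewrite oner_eq0.
have := hA ord0 m; rewrite !mxE /= add0n subn0 modnDr (modn_small (ltn_ord m)) => <-.
congr (_ * _); apply: (mulIf (expf_neq0 (m * k) w0)).
rewrite -exprMn mulVf // expr1n -exprD -mulnDl exprM.
rewrite -[w ^+ (_ %% _ + _)](expr_mod _ wn) modnDml subnK ?(ltnW (ltn_ord m)) //.
by rewrite modnn expr0 expr1n.
Qed.

(** * Entries of the exponential and the effect of state transfer *)

Lemma circ_exp_entry (R : realType) (n' : nat) (w : R[i]) (a : nat -> R[i])
  (l : nat -> R) (t : R) (u v : 'I_n'.+1) (c : R[i]) :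
  n'.+1.-primitive_root w ->
  (forall k, circ_eigenvalue n'.+1 w a k = (l k)%:C) ->
  expmx_entry_is (circ n'.+1 a) t u v c ->
  n'.+1%:R * c = \sum_(k < n'.+1) cis (- (l k * t)) * w ^+ (k * (u + n'.+1 - v)).
Proof.
move=> w_prim lE /cvg_complex_Re_Im [cRe cIm]; set n := n'.+1 in w_prim lE *.
pose z k := w ^+ (k * (u + n - v)).
(* The N-term partial sum of exp(-i l_k t). *)
pose e k N := series (cos_coeff (l k * t)) N +i* (- series (sin_coeff (l k * t)) N).
have partialE N : n%:R * expmx_partial (circ n a) t N u v = \sum_(k < n) e k N * z k.
  rewrite /expmx_partial summxE big_distrr /=.
  under eq_bigr do rewrite mxE mulrCA (circ_pow_entry a w_prim) big_distrr /=.
  rewrite exchange_big; apply: eq_bigr => k _ /=.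
  have -> : e k N = \sum_(m < N) (cos_coeff (l k * t) m +i* (- sin_coeff (l k * t) m)).
    rewrite /e /series /= !big_mkord; elim: N => [|N IH]; first by rewrite !big_ord0 oppr0.
    by rewrite !big_ord_recr /= -IH opprD; simpc.
  rewrite big_distrl; apply: eq_bigr => m _ /=; rewrite mulrA; congr (_ * _).
  by rewrite lE -expNi_coeff rmorphM /= !exprMn; ring.
have eRe k : (fun N => complex.Re (e k N)) @ \oo --> cos (l k * t).
  by rewrite /e /= cos.unlock; exact: is_cvg_series_cos_coeff.
have eIm k : (fun N => complex.Im (e k N)) @ \oo --> - sin (l k * t).
  by rewrite /e /= sin.unlock; apply: cvgN; exact: is_cvg_series_sin_coeff.
have ReM (x y : R[i]) : complex.Re (x * y) =
    complex.Re x * complex.Re y - complex.Im x * complex.Im y by case: x y => ? ? [].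
have ImM (x y : R[i]) : complex.Im (x * y) =
    complex.Re x * complex.Im y + complex.Im x * complex.Re y by case: x y => ? ? [].
have nE : n%:R = (n%:R)%:C :> R[i] by rewrite rmorph_nat.
apply/eqP; rewrite eq_complex; apply/andP; split; apply/eqP.
- rewrite nE ReM /= mul0r subr0 raddf_sum.
  apply: (cvg_unique (@Rhausdorff R) (cvgMl_tmp (a := n%:R) cRe)).
  (* Products are expanded into real and imaginary parts, so that only real series have to
     converge. *)
  rewrite (_ : (fun N => _) = fun N => \sum_(k < n)
      (complex.Re (e k N) * complex.Re (z k) - complex.Im (e k N) * complex.Im (z k))).
    apply: cvg_big => [|k _]; [exact: add_continuous|rewrite /= ReM /= cosN sinN].
    by apply: cvgB; [apply: (cvgMr_tmp (eRe k))|apply: (cvgMr_tmp (eIm k))].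
  apply/funext => N; transitivity (complex.Re (n%:R * expmx_partial (circ n a) t N u v)).
    by rewrite nE ReM /= mul0r subr0.
  by rewrite partialE raddf_sum; apply: eq_bigr => k _; rewrite -ReM.
- rewrite nE ImM /= mul0r addr0 raddf_sum.
  apply: (cvg_unique (@Rhausdorff R) (cvgMl_tmp (a := n%:R) cIm)).
  rewrite (_ : (fun N => _) = fun N => \sum_(k < n)
      (complex.Re (e k N) * complex.Im (z k) + complex.Im (e k N) * complex.Re (z k))).
    apply: cvg_big => [|k _]; [exact: add_continuous|rewrite /= ImM /= cosN sinN].
    by apply: cvgD; [apply: (cvgMr_tmp (eRe k))|apply: (cvgMr_tmp (eIm k))].
  apply/funext => N; transitivity (complex.Im (n%:R * expmx_partial (circ n a) t N u v)).
    by rewrite nE ImM /= mul0r addr0.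
  by rewrite partialE raddf_sum; apply: eq_bigr => k _; rewrite -ImM.
Qed.

Lemma cis_prim_root (R : realType) (n : nat) :
  (0 < n)%N -> n.-primitive_root (cis (pi *+ 2 / n%:R) : R[i]).
Proof.
move=> n_gt0; set x : R := pi *+ 2 / n%:R.
have n0 : n%:R != 0 :> R by rewrite pnatr_eq0 -lt0n.
have pi0 : pi *+ 2 != 0 :> R by rewrite mulrn_eq0 /= gt_eqF // pi_gt0.
have xn : cis x ^+ n = 1 by rewrite -cisMn -mulr_natr divfK // cis2pi.
have [m w_m mn] := prim_order_exists n_gt0 xn.
suff /dvdn_leq -/(_ (prim_order_gt0 w_m)) nm : (n %| m)%N.
  by have -> : n = m by apply/eqP; rewrite eqn_leq nm dvdn_leq.
(* The true order m satisfies 2 pi m/n = 2 pi k for an integer k, so n divides m. *)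
have := prim_expr_order w_m; rewrite -cisMn => /cis_eq1 [k kE].
have {}kE : (m%:Z)%:~R = (k * n%:Z)%:~R :> R.
  rewrite intrM -!pmulrn; apply: (mulIf pi0).
  by rewrite -mulrA [n%:R * _]mulrC mulrA -kE -[x *+ m]mulr_natr mulrAC divfK // mulrC.
by have /intr_inj mE := kE; rewrite -(absz_nat m) mE abszM /= dvdn_mull.
Qed.

(* Entries of a unitary circulant are averages of [n] unit complex numbers, so a
   unimodular entry forces them all to be equal. *)
Lemma universal_pst_circ_spectrum (R : realType) (n' : nat) (a : nat -> R[i])
  (l : nat -> R) (w := cis (pi *+ 2 / n'.+2%:R) : R[i]) :
  (forall k, circ_eigenvalue n'.+2 w a k = (l k)%:C) ->
  universal_pst (circ n'.+2 a) ->
  exists (t : R) (m : nat -> int), forall k, (k < n'.+2)%N ->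
    (l k - l 0%N) * t = k%:R + n'.+2%:R * (m k)%:~R.
Proof.
set n := n'.+2 => lE pst.
have w_prim : n.-primitive_root w := @cis_prim_root R n isT.
have n0 : n%:R != 0 :> R by rewrite pnatr_eq0.
(* Transfer from vertex 0 to vertex 1; [inord 1] is really 1 because n is at least 2. *)
have [t [_ [c [cE c1]]]] := pst ord0 (inord 1).
have := circ_exp_entry w_prim lE cE; rewrite -/n inordK // subn0.
pose F (k : 'I_n) := cis (- (l k * t)) * w ^+ k.
have -> : \sum_(k < n) cis (- (l k * t)) * w ^+ (k * (1 + n)) = \sum_(k < n) F k.
  apply: eq_bigr => k _; rewrite mulnDr muln1 exprD [w ^+ (k * n)]exprM exprAC.
  by rewrite (prim_expr_order w_prim) expr1n mulr1.
have F1 k : `|F k| = 1 by rewrite normrM normrX !norm_cis expr1n mulr1.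
move=> sumF.
have : `|\sum_(k < n) F k| = \sum_(k < n) `|F k|.
  rewrite -sumF normrM c1 mulr1 normr_nat; under eq_bigr do rewrite F1.
  by rewrite sumr_const card_ord.
move=> /normC_sum_eq1 /(_ (fun k _ => F1 k)) [u _ Fu].
(* Here [F k] is compared with [F 0]. The bound on k sits inside the existential, with default 0
   beyond it, so that [choice] gives a function on all naturals. *)
have mex k : exists m : int, (k < n)%N ->
    (l k - l 0%N) * t * n%:R = (k%:R + n%:R * m%:~R) * (pi *+ 2).
  have [kn|_] := ltnP k n; last by exists 0.
  have := Fu ord0 isT; rewrite -(Fu (Ordinal kn) isT) /F /= expr0 mulr1 /w -cisMn -cisD.
  move=> eq0; have /cis_eq1 [m mE] :
      cis ((l k - l 0%N) * t - (pi *+ 2 / n%:R) *+ k) = 1.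
    apply: (mulfI (cis_neq0 (- (l k * t) + pi *+ 2 / n%:R *+ k))).
    by rewrite mulr1 -cisD -eq0; congr cis; ring.
  exists m => _; have {mE} -> : (l k - l 0%N) * t = m%:~R * (pi *+ 2) + (pi *+ 2 / n%:R) *+ k.
    by rewrite -mE subrK.
  by rewrite mulrDl -mulr_natr; field.
(* Rescaling time by n/(2 pi) turns phases 2 pi k/n + 2 pi m into k + n m. *)
exists (t * n%:R / (pi *+ 2)); have /choice[m mP] := mex; exists m => k kn.
by rewrite !mulrA (mP k kn) mulfK // mulrn_eq0 /= gt_eqF // pi_gt0.
Qed.

(** * Density for prime-power order *)

Lemma universal_pst_circ_prime_power (R : realType) (p s : nat) (a : nat -> R[i]) :
  prime p -> hermitian_mx (circ (p ^ s) a) -> universal_pst (circ (p ^ s) a) ->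
  dense_circ (p ^ s) a.
Proof.
move=> p_pr; case nE : (p ^ s)%N => [|[|n']] hA pst j /andP[j_gt0 jn].
(* For n = 0 or 1 there is no index with 0 < j < n. *)
- by [].
- by rewrite ltnS leqNgt j_gt0 in jn.
set n := n'.+2 in nE hA pst jn *.
pose w : R[i] := cis (pi *+ 2 / n%:R).
have w_prim : n.-primitive_root w := @cis_prim_root R n isT.
have wJ : w^* = w^-1.
  by apply: (mulIf (cis_neq0 (pi *+ 2 / n%:R))); rewrite mulVf ?cis_neq0 // conj_cis -cisD addNr cis0.
pose l k := complex.Re (circ_eigenvalue n w a k).
have lE k : circ_eigenvalue n w a k = (l k)%:C.
  have := hermitian_circ_eigenvalue_conj k (prim_expr_order w_prim) wJ hA.
  rewrite /l; case: (circ_eigenvalue _ _ _ _) => x y [] /eqP.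
  by rewrite -subr_eq0 -opprD oppr_eq0 -mulr2n mulrn_eq0 /= => /eqP ->.
have [t [m tE]] := universal_pst_circ_spectrum lE pst.
(* [z] is w^(-j), the root at which Fourier inversion recovers [a j]. *)
apply/eqP => aj0; pose z := w ^+ (n - j).
have zn : z ^+ n = 1 by rewrite exprAC (prim_expr_order w_prim) expr1n.
have z1 : z != 1.
  by rewrite -(prim_order_dvd w_prim) gtnNdvd ?subn_gt0 // ltn_subrL j_gt0.
have sum0 := sum_expr_root zn z1.
have nC0 : n%:R != 0 :> R[i] by rewrite pnatr_eq0.
have nzE k : w ^+ (k * (n - j)) = z ^+ k by rewrite mulnC exprM.
have sumZ : \sum_(k < n) (k%:R + n%:R * (m k)%:~R) * z ^+ k = 0.
  have lz : \sum_(k < n) (l k)%:C * z ^+ k = 0.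
    transitivity (n%:R * a j); last by rewrite aj0 mulr0.
    rewrite -(circ_eigenvalue_inversion a w_prim jn).
    by apply: eq_bigr => k _; rewrite lE nzE.
  (* Shifting all eigenvalues by l_0 is harmless because the powers of z sum to 0. *)
  transitivity (\sum_(k < n) ((l k)%:C * z ^+ k - (l 0%N)%:C * z ^+ k) * t%:C).
    apply: eq_bigr => k _; rewrite -mulrBl mulrAC; congr (_ * _).
    have /(congr1 (real_complex R)) := tE k (ltn_ord k).
    by rewrite [RHS]rmorphD rmorphM rmorphB [in RHS]rmorphM !rmorph_nat rmorph_int => ->.
  by rewrite -big_distrl sumrB lz -big_distrr /= sum0 mulr0 subrr mul0r.
apply: (@one_sub_root_not_unit _ p s z (\sum_(k < n) (m k)%:~R * z ^+ k) p_pr).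
- by rewrite nE.
- have iz := integral_root_of_unity (isT : (0 < n)%N) zn.
  apply: integral_sum => k; apply: integral_mul; last exact: integral_expr.
  exact: (integral_id (intr : {rmorphism int -> R[i]})).
(* After multiplication by n, both sides equal (z - 1) times the sum of k z^k, by [sumZ]. *)
- apply: (mulfI nC0); rewrite mulr1 -[RHS](sum_natmul_expr zn z1).
  move: sumZ; under eq_bigr do rewrite mulrDl -mulrA.
  rewrite big_split /= -big_distrr /= => /eqP; rewrite addr_eq0 => /eqP ->.
  by ring.
Qed.

Theorem theorem8 (R : realType) (n : nat) (a : nat -> R[i]) :
  hermitian_mx (circ n a) ->
  universal_pst (circ n a) ->
  (prime n \/ (exists p : nat, prime p /\ n = (p ^ 2)%N)
           \/ (exists k : nat, n = (2 ^ k)%N)) ->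
  dense_circ n a.
Proof.
move=> hA pst nP.
have [p [s [p_pr nE]]] : exists p s : nat, prime p /\ n = (p ^ s)%N.
  case: nP => [n_pr|[[p [p_pr ->]]|[k ->]]].
  - by exists n, 1%N; rewrite expn1.
  - by exists p, 2%N.
  - by exists 2%N, k.
by rewrite nE in hA pst *; exact: universal_pst_circ_prime_power p_pr hA pst.
Qed.
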